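(* Let $n\ge 1$ and let $\mathbb{F}_q$ be a finite field. The tensor product of any finite number of cluster characters of $U(n,\mathbb{F}_q)$ is equal to a linear combination of cluster characters of $U(n,\mathbb{F}_q)$ with non-negative integer multiplicities.
   Context: $U(n,\mathbb{F}_q)$ is the group of upper triangular unipotent $n\times n$ matrices over $\mathbb{F}_q$, $\mathfrak{u}(n,\mathbb{F}_q)$ is the algebra of upper triangular nilpotent (strictly upper triangular) matrices, and $\mathfrak{u}^*(n,\mathbb{F}_q)$ is its $\mathbb{F}_q$-linear dual. For $g\in U(n,\mathbb{F}_q)$ and $\lambda\in\mathfrak{u}^*(n,\mathbb{F}_q)$ define $(g*\lambda)(X)=\lambda(Xg)$ (left action). Fix a non-trivial homomorphism $\theta$ from the additive group of $\mathbb{F}_q$ to the multiplicative group $\mathbb{C}^\times$. Let $\mathbb{C}[U(n,\mathbb{F}_q)]$ be the space of complex-valued functions on $U(n,\mathbb{F}_q)$, carrying the regular representation $(g*v)(g')=v(g'g)$, and put $v(\lambda)(g)=\theta[\lambda(g-I)]$. For $\lambda\in\mathfrak{u}^*(n,\mathbb{F}_q)$, the span $V(\lambda)$ of $\{v(\mu): \mu=g*\lambda,\ g\in U(n,\mathbb{F}_q)\}$ is a submodule of the regular representation, called a cluster module; its character $\chi(\lambda)$ is called a cluster character. The tensor product of characters is their pointwise product. *)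

(* Defs.v *)
From HB Require Import structures.
From mathcomp Require Import all_boot all_order all_algebra all_fingroup.

Set Implicit Arguments.
Unset Strict Implicit.
Unset Printing Implicit Defensive.

Import GRing.Theory.
Local Open Scope ring_scope.

Section UnitriangularGroup.
Variables (n : nat) (F : finFieldType).

(* {'GL_n[F]} consists of the units of 'M[F]_n.-1.+1, which is 'M[F]_n for
   0 < n; this is why the matrix dimension is written n.-1.+1 throughout. *)
Definition unitriangular (A : 'M[F]_n.-1.+1) : bool :=
  [forall i, A i i == 1] &&
  [forall i : 'I_n.-1.+1, forall j : 'I_n.-1.+1, (j < i)%N ==> (A i j == 0)].

Lemma unitriangularP (A : 'M[F]_n.-1.+1) :
  reflect ((forall i, A i i = 1) /\ (forall i j : 'I_n.-1.+1, (j < i)%N -> A i j = 0))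
          (unitriangular A).
Proof.
apply: (iffP andP) => -[h1 h2]; split.
- by move=> i; apply/eqP/(forallP h1).
- by move=> i j lij; apply/eqP; move/forallP/(_ i)/forallP/(_ j): h2; rewrite lij.
- by apply/forallP => i; apply/eqP.
- by apply/forallP => i; apply/forallP => j; apply/implyP => lij; apply/eqP/h2.
Qed.

Definition unitriangular_set : {set {'GL_n[F]}} :=
  [set g | unitriangular (GLval g)].

Lemma unitriangular_group_set : group_set unitriangular_set.
Proof.
apply/group_setP; split.
  rewrite inE; apply/unitriangularP; split=> [i|i j lij].
    by rewrite /= mxE eqxx.
  by rewrite /= mxE; case: eqP => // eij; rewrite eij ltnn in lij.
move=> x y; rewrite !inE => /unitriangularP[x1 x0] /unitriangularP[y1 y0].
apply/unitriangularP; split=> [i|i j lij]; rewrite GL_ME mxE.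
  rewrite (bigD1 i) //= x1 y1 mulr1 big1 ?addr0 // => k nki.
  have [lki|] := ltnP k i; first by rewrite x0 ?mul0r.
  rewrite leq_eqVlt => /orP[/eqP/val_inj eki|lik]; last by rewrite y0 ?mulr0.
  by rewrite eki eqxx in nki.
rewrite big1 // => k _; have [lki|leik] := ltnP k i; first by rewrite x0 ?mul0r.
by rewrite y0 ?mulr0 //; apply: leq_trans lij leik.
Qed.

Definition unitriangular_group : {group {'GL_n[F]}} :=
  Group unitriangular_group_set.

Definition Ugrp : finGroupType := subg_of unitriangular_group.

Definition Umx (g : Ugrp) : 'M[F]_n.-1.+1 := GLval (sgval g).

Definition ualg : {vspace 'M[F]_n.-1.+1} :=
  <<[seq delta_mx p.1 p.2 | p <- enum [pred p : 'I_n.-1.+1 * 'I_n.-1.+1 | (p.1 < p.2)%N]]>>%VS.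

Lemma ualgP (A : 'M[F]_n.-1.+1) :
  reflect (forall i j : 'I_n.-1.+1, (j <= i)%N -> A i j = 0) (A \in ualg).
Proof.
apply: (iffP idP) => [uA i j lij|A0].
  rewrite (coord_span (X := in_tuple _) uA) summxE big1 // => k _.
  rewrite mxE /=; set s := [seq _ | p <- _] in k *.
  have /mapP[p] : s`_k \in s by apply: mem_nth.
  rewrite mem_enum inE => lp ->; rewrite mxE.
  have [ei|_] := eqVneq i p.1; last by rewrite mulr0.
  have [ej|_] := eqVneq j p.2; last by rewrite mulr0.
  by rewrite ei ej leqNgt lp in lij.
rewrite (matrix_sum_delta A); apply: memv_suml => i _; apply: memv_suml => j _.
have [lij|lji] := ltnP i j; last by rewrite A0 // scale0r mem0v.
by apply/memvZ/memv_span/mapP; exists (i, j); rewrite ?mem_enum.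
Qed.

Definition udual : vectType F := 'Hom(subvs_of ualg, F^o).

(* vsproj ualg restricts the codomain to ualg: it is only applied below to
   matrices that do lie in ualg, see mulmx_ualg and Umx_sub1. *)
Definition dual_act (g : Ugrp) (l : udual) : udual :=
  (l \o linfun (vsproj ualg \o mulmxr (Umx g) \o vsval))%VF.

Lemma mulmx_ualg (g : Ugrp) (A : 'M[F]_n.-1.+1) :
  A \in ualg -> A *m Umx g \in ualg.
Proof.
move=> /ualgP A0; apply/ualgP => i j lji; rewrite mxE big1 // => k _.
have [leki|lik] := leqP k i; first by rewrite A0 ?mul0r.
have: sgval g \in unitriangular_set by apply: (valP g).
rewrite inE => /unitriangularP[_ g0].
by rewrite [Umx g k j]g0 ?mulr0 //; apply: leq_ltn_trans lji lik.
Qed.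

Lemma Umx_sub1 (g : Ugrp) : Umx g - 1%:M \in ualg.
Proof.
have: sgval g \in unitriangular_set by apply: (valP g).
rewrite inE => /unitriangularP[g1 g0].
apply/ualgP => i j; rewrite !mxE leq_eqVlt => /orP[/eqP/val_inj->|lij].
  by rewrite eqxx [Umx g i i]g1 subrr.
rewrite [Umx g i j]g0 //; case: eqP => [eij|_]; last by rewrite subrr.
by rewrite eij ltnn in lij.
Qed.

Lemma dual_actE (g : Ugrp) (l : udual) (X : subvs_of ualg) :
  dual_act g l X = l (vsproj ualg (vsval X *m Umx g)).
Proof. by rewrite comp_lfunE lfunE. Qed.

End UnitriangularGroup.

Section ClusterModules.
Variables (n : nat) (F : finFieldType) (C : fieldType) (theta : F -> C).

Definition Ufun : vectType C := {ffun Ugrp n F -> C^o}.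

Definition regular_fun (g : Ugrp n F) (v : Ufun) : Ufun :=
  [ffun h => v (h * g)%g].

Lemma regular_fun_is_linear g : linear (regular_fun g).
Proof. by move=> a u v; apply/ffunP => h; rewrite !ffunE. Qed.

HB.instance Definition _ g :=
  GRing.isLinear.Build C Ufun Ufun _ (regular_fun g) (regular_fun_is_linear g).

Definition regular_act (g : Ugrp n F) : 'End(Ufun) := linfun (regular_fun g).

Definition cluster_fun (l : udual n F) : Ufun :=
  [ffun g => theta (l (vsproj (ualg n F) (Umx g - 1%:M)))].

Definition cluster_module (l : udual n F) : {vspace Ufun} :=
  <<[seq cluster_fun (dual_act g l) | g : Ugrp n F]>>%VS.

(* The matrix of the restriction of T to V in a basis of V; this is meaningful
   when V is stable under T, see cluster_module_stable. *)
Definition trace_on (vT : vectType C) (V : {vspace vT}) (T : 'End(vT)) : C :=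
  \tr (\matrix_(i, j < \dim V) coord (vbasis V) i (T (vbasis V)`_j)).

Definition cluster_char (l : udual n F) (g : Ugrp n F) : C :=
  trace_on (cluster_module l) (regular_act g).

Lemma UmxM (g h : Ugrp n F) : Umx (g * h)%g = Umx g *m Umx h.
Proof. by []. Qed.

Lemma regular_cluster_fun (g : Ugrp n F) (l : udual n F) :
  {morph theta : x y / x + y >-> x * y} ->
  regular_act g (cluster_fun l) =
    cluster_fun l g *: cluster_fun (dual_act g l).
Proof.
move=> thetaD; apply/ffunP => h; rewrite lfunE /= !ffunE -[RHS]thetaD dual_actE.
have hgB : Umx (h * g)%g - 1%:M = Umx g - 1%:M + (Umx h - 1%:M) *m Umx g.
  by rewrite UmxM mulmxBl mul1mx [RHS]addrC addrA subrK.
by congr theta; rewrite -[RHS](linearD l) -linearD vsprojK ?Umx_sub1 //= hgB.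
Qed.

Lemma dual_actM (g h : Ugrp n F) (l : udual n F) :
  dual_act g (dual_act h l) = dual_act (g * h)%g l.
Proof.
apply/lfunP => X; rewrite !dual_actE vsprojK ?mulmx_ualg ?subvsP //.
by rewrite UmxM mulmxA.
Qed.

Lemma cluster_module_stable (g : Ugrp n F) (l : udual n F) :
  {morph theta : x y / x + y >-> x * y} ->
  (regular_act g @: cluster_module l <= cluster_module l)%VS.
Proof.
move=> thetaD; rewrite limg_span; apply/span_subvP => v /mapP[w /imageP[h _ ->] ->].
rewrite regular_cluster_fun // dual_actM; apply/memvZ/memv_span.
by apply/imageP; exists (g * h)%g.
Qed.

End ClusterModules.

(* Main.v *)
From HB Require Import structures.
Require Import Defs.
From mathcomp Require Import all_boot all_order all_algebra all_fingroup.
From mathcomp Require Import all_field complex reals.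

Set Implicit Arguments.
Unset Strict Implicit.
Unset Printing Implicit Defensive.

Import GRing.Theory Num.Theory.
Local Open Scope ring_scope.

(** Write u for the strictly upper triangular matrices. The functions v(m) with
    m in u* are the distinct characters of the additive group u transported to
    U = 1 + u, hence linearly independent; U permutes the lines they span, so
    chi(l)(g) is the sum of theta(m(g - 1)) over the points m of the orbit U * l
    fixed by g (cluster_char_fixed). Expanding a product of cluster characters
    gives the analogous sum over the g-fixed families (m_j) in a product of
    orbits, with m replaced by the sum of the m_j, since v(m) v(m') = v(m + m')
    (prod_cluster_char).

    Split the product of orbits into U-orbits. The stabiliser of a family is
    1 + L, where L is the intersection of the left annihilators
    {Y in u | m_j(u Y) = 0}: a left ideal of u. The contribution of one orbit is
    therefore the character I(L, m) induced from the linear character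
    1 + Y |-> theta(m(Y)) of 1 + L, where m is the sum of the m_j
    (family_orbit_sum). For a single functional l and L its full left
    annihilator, I(L, l) is chi(l) (induced_left_ann). In general L is only
    contained in the left annihilator A of m, and I(L, m) has to be decomposed.

    If L is smaller than A, nilpotency of u gives y in A outside L with u y
    contained in L. Then M = L + <y> is again a left ideal. Let phi be a
    functional that vanishes on L with phi(y) = 1. By orthogonality of the
    characters of F, the sum over c in F of theta(m + c phi) is |F| theta(m) on L
    and 0 on the rest of M, so I(L, m) is the sum over c of I(M, m + c phi)
    (induced_char_step). The functionals m + c phi still vanish on u M because
    u M is contained in L. Iterating, each branch ends with a left ideal that is
    the whole left annihilator of its functional, that is, with a cluster
    character (induced_char_cluster_sum). *)

(** * Traces, separating functionals, orbit sums and additive characters *)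

Section LinearAlgebra.
Variables (K : fieldType) (vT : vectType K).

(** A dual family e replaces the coordinates in the chosen basis of V: it makes x
    a basis of V, and the trace does not depend on the basis. *)
Lemma trace_on_biorthogonal (I : finType) (P : pred I) (x : I -> vT)
    (e : I -> {linear vT -> K^o}) (V : {vspace vT}) (T : 'End(vT)) :
    (forall i j, P i -> P j -> e i (x j) = (i == j)%:R) ->
    V = <<[seq x i | i in P]>>%VS -> (T @: V <= V)%VS ->
  trace_on V T = \sum_(i | P i) e i (T (x i)).
Proof.
move=> ex defV TV.
have xV i : P i -> x i \in V.
  by move=> Pi; rewrite defV memv_span //; apply/imageP; exists i.
have TxV v : v \in V -> T v \in V.
  by move=> vV; apply: (subvP TV); apply: memv_img.
have expand v : v \in V -> v = \sum_(i | P i) e i v *: x i.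
  rewrite defV; pose X := in_tuple [seq x i | i in P]; pose c := coord X.
  move=> /(coord_span (X := X)) ->.
  have span_expand (k : 'I_(size [seq x i | i in P])) :
      X`_k = \sum_(i | P i) e i X`_k *: x i.
    have /imageP[j Pj ->] : X`_k \in [seq x i | i in P] by apply: mem_nth.
    rewrite (bigD1 j) //= ex // eqxx scale1r big1 ?addr0 // => i /andP[Pi nij].
    by rewrite ex // (negPf nij) scale0r.
  transitivity (\sum_k \sum_(i | P i) (c k v * e i X`_k) *: x i).
    apply: eq_bigr => k _; rewrite {1}span_expand scaler_sumr.
    by apply: eq_bigr => i _; rewrite scalerA.
  rewrite exchange_big; apply: eq_bigr => i _ /=.
  by rewrite linear_sum scaler_suml; apply: eq_bigr => k _; rewrite linearZ.
set b := vbasis V; rewrite /trace_on /mxtrace.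
transitivity (\sum_(k < \dim V) \sum_(i | P i) e i b`_k * coord b k (T (x i))).
  apply: eq_bigr => k _; rewrite mxE.
  have bV : b`_k \in V by apply: vbasis_mem; rewrite mem_nth ?size_tuple.
  rewrite {1}(expand _ bV) !linear_sum; apply: eq_bigr => i _.
  by rewrite !linearZ.
rewrite exchange_big; apply: eq_bigr => i Pi /=.
rewrite [in RHS](coord_vbasis (TxV _ (xV i Pi))) linear_sum.
by apply: eq_bigr => k _; rewrite linearZ mulrC.
Qed.

Lemma separating_functional (L : {vspace vT}) (m : vT) :
  m \notin L -> exists2 phi : 'Hom(vT, K^o), (L <= lker phi)%VS & phi m = 1.
Proof.
move=> mL; pose X := [tuple of m :: vbasis L].
have freeX : free X.
  by rewrite free_cons (span_basis (vbasisP L)) mL (basis_free (vbasisP L)).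
pose phi : 'Hom(vT, K^o) := linfun (coord X ord0 : vT -> K^o).
have phiE v : phi v = coord X ord0 v by rewrite lfunE.
exists phi; last by rewrite phiE; apply: (coord_free ord0 ord0 freeX).
rewrite -[X in (X <= _)%VS](span_basis (vbasisP L)).
apply/span_subvP => v /(nthP 0)[k ltk <-]; rewrite memv_ker phiE.
rewrite size_tuple in ltk.
by have := coord_free (lift ord0 (Ordinal ltk)) ord0 freeX => /= /eqP.
Qed.

Lemma dimv_add_line (L : {vspace vT}) (m : vT) :
  m \notin L -> (\dim (L + <[m]>) = (\dim L).+1)%N.
Proof.
move=> mL; rewrite dimv_disjoint_sum ?dim_vline; last first.
  apply/eqP; rewrite -subv0; apply/subvP => v /memv_capP[vL /vlineP[k vk]].
  by move: vL; rewrite vk rpredZeq (negPf mL) orbF => /eqP->; rewrite scale0r mem0v.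
by have [m0|] := eqVneq m 0; rewrite ?addn1 //; rewrite m0 mem0v in mL.
Qed.

Lemma separating_functional_ker (L : {vspace vT}) (m : vT) (phi : 'Hom(vT, K^o)) :
    (L <= lker phi)%VS -> phi m = 1 ->
  forall A, A \in (L + <[m]>)%VS -> (phi A == 0) = (A \in L).
Proof.
move=> Lphi phim _ /memv_addP[v vL [_ /vlineP[k ->] ->]].
have phiv : phi v = 0 by apply/eqP; rewrite -memv_ker (subvP Lphi).
have mL : m \notin L.
  by apply: contraTN (oner_neq0 K) => /(subvP Lphi); rewrite memv_ker phim negbK.
rewrite linearD linearZ /= phiv phim add0r rpredDl // rpredZeq (negPf mL) orbF.
by rewrite [k *: _]mulr1.
Qed.

End LinearAlgebra.

Section OrbitSums.
Variables (aT : finGroupType) (rT : finType) (to : {action aT &-> rT}).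

(** Each point of the orbit is reached by a whole coset of the stabiliser of x. *)
Lemma sum_over_group_orbit (V : nmodType) (x : rT) (E : rT -> V) :
  \sum_(a : aT) E (to x a) =
    (\sum_(y in orbit to [set: aT] x) E y) *+ #|('C[x | to])%g|.
Proof.
rewrite (partition_big (to x) (mem (orbit to [set: aT] x))) /=; last first.
  by move=> a _; apply/mem_orbit/in_setT.
rewrite -sumrMnl; apply: eq_bigr => y /orbitP[b _ <-].
rewrite (eq_bigr (fun=> E (to x b))) => [|a /eqP-> //].
rewrite sumr_const; congr (_ *+ _).
rewrite -['C[x | to]%g]setTI -(card_rcoset _ b).
rewrite -amove_act ?subsetT ?inE //.
by apply: eq_card => a; rewrite !inE.
Qed.

End OrbitSums.

Section AdditiveCharacters.
Variables (F : finFieldType) (C : fieldType) (theta : F -> C).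
Hypothesis theta_neq0 : forall x, theta x != 0.
Hypothesis thetaD : {morph theta : x y / x + y >-> x * y}.

Lemma theta0 : theta 0 = 1.
Proof. by apply: (mulfI (theta_neq0 0)); rewrite -thetaD addr0 mulr1. Qed.

Lemma theta_sum (I : Type) (r : seq I) (P : pred I) (f : I -> F) :
  theta (\sum_(i <- r | P i) f i) = \prod_(i <- r | P i) theta (f i).
Proof. exact: (big_morph theta thetaD theta0). Qed.

Hypothesis theta_nontrivial : exists x, theta x != 1.

(** Translating the summation variable by a vector of U at which theta \o k is not
    1 multiplies the sum by a factor other than 1. *)
Lemma sum_theta_functional (p : nat) (U : {vspace 'M[F]_p})
    (k : 'Hom('M[F]_p, F^o)) (m : 'M[F]_p) :
  m \in U -> k m != 0 -> \sum_(v : 'M[F]_p | v \in U) theta (k v) = 0.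
Proof.
move=> mU km0; have [x thx] := theta_nontrivial.
pose w : 'M[F]_p := (x / k m) *: m.
have kw : k w = x by rewrite linearZ; apply: divfK.
set S := LHS.
have : S = theta x * S.
  rewrite {1}/S (reindex_inj (addrI w)) mulr_sumr.
  apply: eq_big => v; first by rewrite rpredDl // memvZ.
  by move=> _; rewrite linearD /= kw; apply: thetaD.
move/eqP; rewrite -{1}[S]mul1r -subr_eq0 -mulrBl mulf_eq0 subr_eq0 eq_sym.
by rewrite (negPf thx) => /eqP.
Qed.

Lemma sum_theta_scale (a : F) :
  \sum_(c : F) theta (c * a) = if a == 0 then #|F|%:R else 0.
Proof.
case: eqP => [->|/eqP a0].
  rewrite (eq_bigr (fun=> 1)) ?sumr_const // => c _.
  by rewrite mulr0 theta0.
have [x thx] := theta_nontrivial; set S := LHS.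
have : S = theta x * S.
  rewrite {1}/S (reindex_inj (addrI (x / a))) mulr_sumr.
  by apply: eq_bigr => c _; rewrite mulrDl divfK // thetaD.
move/eqP; rewrite -{1}[S]mul1r -subr_eq0 -mulrBl mulf_eq0 subr_eq0 eq_sym.
by rewrite (negPf thx) => /eqP.
Qed.

End AdditiveCharacters.

(** * Functionals on the strictly upper triangular matrices *)

Section UnitriangularDual.
Variables (n : nat) (F : finFieldType).
Local Notation matrixF := 'M[F]_n.-1.+1.
Local Notation u := (ualg n F).
Implicit Types (A X Y : matrixF) (g h : Ugrp n F) (l : udual n F).
Implicit Types (L : {vspace matrixF}).

(** Functionals are evaluated on plain matrices, through the projection onto u, so
    that matrix products need not be cast into the subspace type. *)
Definition dual_extend (l : udual n F) : 'Hom(matrixF, F^o) :=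
  (l \o linfun (vsproj u))%VF.

Definition dual_restrict (phi : 'Hom(matrixF, F^o)) : udual n F :=
  (phi \o linfun vsval)%VF.

Lemma dual_extendE l A : dual_extend l A = l (vsproj u A).
Proof. by rewrite comp_lfunE lfunE. Qed.

Lemma dual_restrictK phi A : A \in u -> dual_extend (dual_restrict phi) A = phi A.
Proof. by move=> uA; rewrite dual_extendE comp_lfunE lfunE /= vsprojK. Qed.

Lemma dual_extend_sum (J : Type) (r : seq J) (f : J -> udual n F) A :
  dual_extend (\sum_(j <- r) f j) A = \sum_(j <- r) dual_extend (f j) A.
Proof.
rewrite dual_extendE sum_lfunE; apply: eq_bigr => j _.
by rewrite dual_extendE.
Qed.

Lemma dual_extend_act g l A :
  A \in u -> dual_extend (dual_act g l) A = dual_extend l (A *m Umx g).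
Proof. by move=> uA; rewrite !dual_extendE dual_actE vsprojK. Qed.

Lemma dual_extend_inj l l' :
  (forall A, A \in u -> dual_extend l A = dual_extend l' A) -> l = l'.
Proof.
move=> ll'; apply/lfunP => X; have := ll' _ (subvsP X).
by rewrite !dual_extendE vsvalK.
Qed.

Lemma ualg_mulmx X Y : X \in u -> Y \in u -> X *m Y \in u.
Proof.
move=> /ualgP X0 /ualgP Y0; apply/ualgP => i j lji; rewrite mxE big1 // => k _.
have [lki|lik] := leqP k i; first by rewrite X0 ?mul0r.
by rewrite Y0 ?mulr0 //; apply: leq_trans lji (ltnW lik).
Qed.

Lemma Umx_inj : injective (@Umx n F).
Proof. by move=> g h /val_inj/val_inj. Qed.

Lemma Umx_onto A : A \in u -> exists g : Ugrp n F, Umx g - 1%:M = A.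
Proof.
move=> /ualgP A0; pose B : matrixF := 1%:M + A.
have B1 i : B i i = 1 by rewrite !mxE eqxx A0 ?addr0.
have B0 (i j : 'I_n.-1.+1) : (j < i)%N -> B i j = 0.
  move=> lji; rewrite !mxE (A0 _ _ (ltnW lji)) addr0.
  by case: eqP lji => // ->; rewrite ltnn.
have unitB : B \is a GRing.unit.
  rewrite [_ \is a _]unitmxE -det_tr det_trig; last first.
    by apply/is_trig_mxP => i j lij; rewrite mxE B0.
  by rewrite big1 ?unitr1 // => i _; rewrite mxE B1.
pose b : {'GL_n[F]} := FinRing.Unit unitB.
have UB : b \in unitriangular_group n F.
  by rewrite in_set; apply/unitriangularP.
exists (Subg UB); have -> : Umx (Subg UB) = B by [].
by rewrite /B addrC addKr.
Qed.

Lemma sum_Umx_sub1 (V : nmodType) (f : matrixF -> V) (P : pred matrixF) :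
  \sum_(g : Ugrp n F | P (Umx g - 1%:M)) f (Umx g - 1%:M) =
    \sum_(A | (A \in u) && P A) f A.
Proof.
have inj1 : injective (fun g : Ugrp n F => Umx g - 1%:M).
  by move=> g h /addIr/Umx_inj.
rewrite big_mkcond [RHS]big_mkcondr /=.
transitivity
  (\sum_(A in [set Umx g - 1%:M | g : Ugrp n F]) if P A then f A else 0).
  by rewrite big_imset //= => g h _ _; apply: inj1.
apply: eq_bigl => A; apply/imsetP/idP => [[g _ ->]|uA]; first exact: Umx_sub1.
by have [g <-] := Umx_onto uA; exists g.
Qed.

Lemma Umx_conj_sub1 g h :
  Umx h *m (Umx (g ^ h)%g - 1%:M) = (Umx g - 1%:M) *m Umx h.
Proof. by rewrite mulmxBl mulmxBr mul1mx mulmx1 -!UmxM -conjgC. Qed.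

Definition left_ann (l : udual n F) : {vspace matrixF} :=
  (u :&: \bigcap_(X : matrixF | X \in u)
            lker (dual_extend l \o linfun (mulmx X))%VF)%VS.

Lemma left_annP l A :
  reflect (A \in u /\ forall X, X \in u -> dual_extend l (X *m A) = 0)
          (A \in left_ann l).
Proof.
have annE X : (A \in lker (dual_extend l \o linfun (mulmx X))%VF) =
              (dual_extend l (X *m A) == 0).
  by rewrite memv_ker -[in RHS](lfunE (mulmx X)) -comp_lfunE.
rewrite memv_cap; apply: (iffP andP) => -[uA A0]; split=> //.
  move=> X uX; move: A0; rewrite memvE => /subv_bigcapP/(_ X uX).
  by rewrite -memvE annE => /eqP.
rewrite memvE; apply/subv_bigcapP => X uX.
by rewrite -memvE annE A0.
Qed.

Definition left_ideal L := forall X Y, X \in u -> Y \in L -> X *m Y \in L.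

Lemma left_ann_ideal l : left_ideal (left_ann l).
Proof.
move=> X Y uX /left_annP[uY Y0]; apply/left_annP; split; first exact: ualg_mulmx.
by move=> Z uZ; rewrite mulmxA Y0 // ualg_mulmx.
Qed.

Lemma left_annU l A : A \in left_ann l -> A \in u.
Proof. by case/left_annP. Qed.

(** g fixes l exactly when l(X (g - 1)) = 0 for all X in u: the stabiliser of l is
    1 + left_ann l. *)
Lemma dual_act_fixed g l : (dual_act g l == l) = (Umx g - 1%:M \in left_ann l).
Proof.
apply/eqP/left_annP => [gl|[_ g0]].
  split=> [|X uX]; first exact: Umx_sub1.
  by rewrite mulmxBr mulmx1 linearB /= -dual_extend_act // gl subrr.
apply: dual_extend_inj => A uA; apply/eqP.
by rewrite dual_extend_act // -subr_eq0 -linearB /= -{2}[A]mulmx1 -mulmxBr g0.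
Qed.

Lemma dual_act1 l : dual_act 1%g l = l.
Proof.
apply: dual_extend_inj => A uA.
by rewrite dual_extend_act // [Umx _]/= mulmx1.
Qed.

Lemma dual_act_inj g : injective (@dual_act n F g).
Proof.
by apply: (can_inj (g := dual_act g^-1)) => l; rewrite dual_actM mulVg dual_act1.
Qed.

Lemma dual_act_fixed_conj g h l :
  (dual_act g (dual_act h l) == dual_act h l) = (Umx (g ^ h)%g - 1%:M \in left_ann l).
Proof.
by rewrite dual_actM conjgC -dual_actM (inj_eq (@dual_act_inj h)) dual_act_fixed.
Qed.

(** With Y = h^-1 (g - 1) h, the left side is l(h Y) = l(Y) + l((h - 1) Y), and the
    last term vanishes because Y lies in the left annihilator of l. *)
Lemma dual_extend_fixed g h l :
    Umx (g ^ h)%g - 1%:M \in left_ann l ->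
  dual_extend (dual_act h l) (Umx g - 1%:M) =
    dual_extend l (Umx (g ^ h)%g - 1%:M).
Proof.
move=> /left_annP[_ ghl]; rewrite dual_extend_act ?Umx_sub1 // -Umx_conj_sub1.
by rewrite -[Umx h](subrK 1%:M) mulmxDl mul1mx linearD /= ghl ?add0r ?Umx_sub1.
Qed.

(** Multiplying on the left by a strictly upper triangular matrix kills the last
    nonzero row, so u sends into L any element of N outside L whose last nonzero
    row is as high as possible. *)
Lemma exists_minimal_step L N :
    left_ideal N -> (N <= u)%VS -> ~~ (N <= L)%VS ->
  exists m, [/\ m \in N, m \notin L & forall X, X \in u -> X *m m \in L].
Proof.
move=> idN Nu NL.
suff step d Y : Y \in N -> Y \notin L ->
    (forall i j : 'I_n.-1.+1, (d <= i)%N -> Y i j = 0) ->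
    exists m, [/\ m \in N, m \notin L & forall X, X \in u -> X *m m \in L].
  have [Y YN YL] := subvPn NL; apply: (step n.-1.+1 Y YN YL) => i j.
  by rewrite leqNgt ltn_ord.
elim: d Y => [|d IHd] Y YN YL Y0.
  case/negP: YL; rewrite (_ : Y = 0) ?mem0v //.
  by apply/matrixP=> i j; rewrite Y0 ?mxE.
have [/forall_inP uYL|] := boolP [forall (X | X \in u), X *m Y \in L].
  by exists Y.
case/forall_inPn=> X uX XYL; apply: (IHd _ (idN _ _ uX YN) XYL) => i j ledi.
rewrite mxE big1 // => k _; have [leki|ltik] := leqP k i.
  by rewrite (ualgP _ uX) ?mul0r.
by rewrite Y0 ?mulr0 //; apply: leq_ltn_trans ledi ltik.
Qed.

End UnitriangularDual.

(** * Cluster characters as sums over fixed points *)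

Section ClusterCharacters.
Variables (n : nat) (F : finFieldType) (C : numFieldType) (theta : F -> C).
Hypothesis theta_neq0 : forall x, theta x != 0.
Hypothesis thetaD : {morph theta : x y / x + y >-> x * y}.
Hypothesis theta_nontrivial : exists x, theta x != 1.
Local Notation matrixF := 'M[F]_n.-1.+1.
Local Notation u := (ualg n F).
Local Notation fdual := (finvect_type (udual n F)).
Implicit Types (A X Y : matrixF) (g h : Ugrp n F) (l : udual n F).
Implicit Types (L : {vspace matrixF}).

Lemma card_field_neq0 d : (#|F| ^ d)%:R != 0 :> C.
Proof. by rewrite pnatr_eq0 -lt0n expn_gt0 (ltnW (card_finNzRing_gt1 F)). Qed.

Lemma sum_cluster_fun l :
  \sum_(g : Ugrp n F) cluster_fun theta l g =
    if l == 0 then (#|F| ^ \dim u)%:R else 0.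
Proof.
transitivity (\sum_(A : matrixF | A \in u) theta (dual_extend l A)).
  rewrite -(eq_bigl _ _ (fun A => andbT _)) -(sum_Umx_sub1 _ xpredT).
  by apply: eq_bigr => g _; rewrite ffunE dual_extendE.
case: eqP => [->|/eqP l0].
  rewrite (eq_bigr (fun=> 1)) ?sumr_const ?card_vspace // => A _.
  by rewrite dual_extendE zero_lfunE (theta0 theta_neq0 thetaD).
have [|/forall_inPn[m um lm]] := boolP [forall (A | A \in u), dual_extend l A == 0].
  move=> /forall_inP l'0; case/negP: l0; apply/eqP/dual_extend_inj => A uA.
  by rewrite (eqP (l'0 A uA)) dual_extendE zero_lfunE.
exact: (sum_theta_functional thetaD theta_nontrivial um lm).
Qed.

(** The Fourier coefficient of v at l; since theta (- x) is the inverse of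
    theta x, the function of - l plays the part of the complex conjugate. *)
Definition cluster_coef (l : udual n F) (v : Ufun n F C) : C :=
  (#|F| ^ \dim u)%:R^-1 * \sum_(g : Ugrp n F) cluster_fun theta (- l) g * v g.

Lemma cluster_coef_is_linear l : linear (cluster_coef l : Ufun n F C -> C^o).
Proof.
move=> a v w.
change (cluster_coef l (a *: v + w) =
        a * cluster_coef l v + cluster_coef l w :> C).
rewrite /cluster_coef mulrCA -mulrDr; congr (_ * _).
rewrite mulr_sumr -big_split; apply: eq_bigr => g _.
by rewrite !ffunE mulrDr mulrCA.
Qed.

HB.instance Definition _ l :=
  GRing.isLinear.Build C (Ufun n F C) C^o _
    (cluster_coef l) (cluster_coef_is_linear l).

Lemma cluster_coef_fun l l' : cluster_coef l (cluster_fun theta l') = (l == l')%:R.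
Proof.
rewrite /cluster_coef.
transitivity ((#|F| ^ \dim u)%:R^-1 *
              \sum_(g : Ugrp n F) cluster_fun theta (l' - l) g).
  by congr (_ * _); apply: eq_bigr => g _; rewrite !ffunE add_lfunE mulrC -thetaD.
rewrite sum_cluster_fun subr_eq0 eq_sym; case: eqP => _; last by rewrite mulr0.
by rewrite mulVf ?card_field_neq0.
Qed.

Definition cluster l : {set fdual} := [set (dual_act g l : fdual) | g : Ugrp n F].

(** The v(m) with m in the orbit form a basis of the cluster module, in which g acts
    by a monomial matrix: v(m) goes to a multiple of v(g * m), so only the fixed
    points m contribute to the trace. *)
Lemma cluster_char_fixed l g :
  cluster_char theta l g =
    \sum_(m in cluster l | dual_act g m == m) theta (dual_extend m (Umx g - 1%:M)).
Proof.
rewrite /cluster_char (@trace_on_biorthogonal _ _ fdual (mem (cluster l))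
  (cluster_fun theta) cluster_coef).
- rewrite big_mkcondr; apply: eq_bigr => m _.
  rewrite regular_cluster_fun // linearZ /= cluster_coef_fun eq_sym ffunE dual_extendE.
  by case: eqP => _; [apply: mulr1 | apply: mulr0].
- by move=> l1 l2 _ _; apply: cluster_coef_fun.
- apply: eq_span => v; apply/imageP/imageP => [[h _ ->]|[m /imsetP[h _ ->] ->]].
    by exists (dual_act h l) => //; apply: imset_f.
  by exists h.
exact: cluster_module_stable.
Qed.

Section Families.
Variable J : finType.
Implicit Types f : {ffun J -> fdual}.

(** The inverse turns the left action on functionals into a right action. *)
Definition family_act f g : {ffun J -> fdual} := [ffun j => dual_act g^-1%g (f j)].

Lemma family_act1 : family_act^~ 1%g =1 id.
Proof.
by move=> f; apply/ffunP => j; rewrite ffunE invg1 dual_act1.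
Qed.

Lemma family_actM f : act_morph family_act f.
Proof. by move=> g h; apply/ffunP => j; rewrite !ffunE dual_actM invMg. Qed.

Canonical family_action := TotalAction family_act1 family_actM.

Definition family_ann f : {vspace matrixF} := (u :&: \bigcap_j left_ann (f j))%VS.

Lemma family_annP f A :
  reflect (A \in u /\ forall j, A \in left_ann (f j)) (A \in family_ann f).
Proof.
rewrite memv_cap; apply: (iffP andP) => -[uA fA]; split=> //.
  by move=> j; move: fA; rewrite !memvE => /subv_bigcapP; apply.
by rewrite memvE; apply/subv_bigcapP => j _; rewrite -memvE.
Qed.

Lemma family_fixed_conj f g h :
  [forall j, dual_act g (dual_act h (f j)) == dual_act h (f j)] =
    (Umx (g ^ h)%g - 1%:M \in family_ann f).
Proof.
apply/forallP/family_annP => [fg|[_ fg] j]; last by rewrite dual_act_fixed_conj.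
by split=> [|j]; rewrite ?Umx_sub1 // -dual_act_fixed_conj.
Qed.

Lemma card_family_stab f :
  #|('C[f | family_action])%g| = (#|F| ^ \dim (family_ann f))%N.
Proof.
rewrite -card_vspace -!sum1_card.
transitivity (\sum_(A | (A \in u) && (A \in family_ann f)) 1)%N; last first.
  apply: eq_bigl => A; rewrite andb_idl // => /family_annP[uA _]; exact: uA.
rewrite -(sum_Umx_sub1 (fun=> 1%N)); apply: eq_bigl => g.
rewrite -[g in RHS](conjg1 g) -family_fixed_conj -groupV.
apply/astab1P/forallP => [/ffunP fg j|fg].
  by have := fg j; rewrite ffunE invgK !dual_act1 => ->.
apply/ffunP => j; rewrite ffunE invgK.
by have /eqP := fg j; rewrite dual_act1.
Qed.

(** For a left ideal L on which l(u L) = 0, this is the value at g of the character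
    of U induced from the linear character 1 + Y |-> theta(l(Y)) of 1 + L, a
    subgroup of order #|F| ^ \dim L. *)
Definition induced_char L l g : C :=
  (#|F| ^ \dim L)%:R^-1 *
  \sum_(h : Ugrp n F | Umx (g ^ h)%g - 1%:M \in L)
     theta (dual_extend l (Umx (g ^ h)%g - 1%:M)).

(** The span of the lines indexed by the orbit of f is a module induced from the
    stabiliser 1 + family_ann f. *)
Lemma family_orbit_sum f g :
  \sum_(f' in orbit family_action [set: Ugrp n F] f
          | [forall j, dual_act g (f' j) == f' j])
     theta (dual_extend (\sum_j (f' j : udual n F)) (Umx g - 1%:M)) =
  induced_char (family_ann f) (\sum_j (f j : udual n F)) g.
Proof.
rewrite big_mkcondr /=.
pose E (f' : {ffun J -> fdual}) : C :=
  if [forall j, dual_act g (f' j) == f' j]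
  then theta (dual_extend (\sum_j (f' j : udual n F)) (Umx g - 1%:M)) else 0.
have := sum_over_group_orbit family_action f E; rewrite card_family_stab => sumE.
apply: (mulfI (card_field_neq0 (\dim (family_ann f)))).
rewrite mulrA divff ?card_field_neq0 // mul1r mulr_natl -[LHS]sumE.
rewrite (reindex_inj invg_inj) [RHS]big_mkcond; apply: eq_bigr => h _.
have actE j : (family_act f h^-1%g j : udual n F) = dual_act h (f j).
  by rewrite ffunE invgK.
rewrite /E [family_action _ _]/=.
under eq_forallb => j do rewrite actE.
rewrite family_fixed_conj; case: ifP => // /family_annP[_ fgh].
congr theta; rewrite !dual_extend_sum; apply: eq_bigr => j _.
by rewrite actE dual_extend_fixed.
Qed.

Lemma prod_cluster_char (ls : J -> udual n F) g :
  \prod_j cluster_char theta (ls j) g =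
  \sum_(f in [set f : {ffun J -> fdual} | [forall j, f j \in cluster (ls j)]]
          | [forall j, dual_act g (f j) == f j])
     theta (dual_extend (\sum_j (f j : udual n F)) (Umx g - 1%:M)).
Proof.
under eq_bigr => j _ do rewrite cluster_char_fixed.
rewrite bigA_distr_big_dep; apply: eq_big => f.
  rewrite inE; apply/familyP/andP => [fP|[/forallP fC /forallP fg] j].
    by split; apply/forallP => j; have /andP[] := fP j.
  by apply/andP; split; [apply: fC | apply: fg].
by move=> _; rewrite dual_extend_sum theta_sum.
Qed.

End Families.

(** The orbit of l is the orbit of the one-term family l, and one-term families
    express its cluster character as a product with a single factor. *)
Lemma induced_left_ann l g : induced_char (left_ann l) l g = cluster_char theta l g.
Proof.
pose f : {ffun 'I_1 -> fdual} := [ffun=> l].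
have annf : family_ann f = left_ann l.
  apply/vspaceP => A; apply/family_annP/idP => [[_ /(_ ord0)]|lA].
    by rewrite ffunE.
  by split=> [|j]; rewrite ?ffunE //; apply: left_annU lA.
have := prod_cluster_char (fun _ : 'I_1 => l) g; rewrite big_ord1 => ->.
have := family_orbit_sum f g; rewrite annf big_ord1 ffunE => <-.
apply: eq_bigl => f'; congr (_ && _); rewrite inE.
apply/orbitP/forallP => [[h _ <-] j|/(_ ord0)/imsetP[h _ f'h]].
  by rewrite !ffunE; apply: imset_f.
exists h^-1%g; rewrite ?inE //; apply/ffunP => j.
by rewrite !ffunE invgK ord1 f'h.
Qed.

(** * Decomposition of the induced characters *)

(** The functionals l + c phi are the |F| extensions of l from L to L + <[m]>, and
    the sum of their characters is |F| times the indicator function of L times the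
    character of l; the factor |F| is the index of 1 + L in 1 + (L + <[m]>). *)
Lemma induced_char_step L l m (phi : 'Hom(matrixF, F^o)) g :
    (L <= u)%VS -> m \in u -> m \notin L -> (L <= lker phi)%VS -> phi m = 1 ->
  induced_char L l g =
    \sum_(c : F) induced_char (L + <[m]>) (l + c *: dual_restrict phi) g.
Proof.
move=> Lu mu mL Lphi phim; rewrite -mulr_sumr exchange_big /= dimv_add_line //.
have Mu A : A \in (L + <[m]>)%VS -> A \in u.
  by apply/subvP; rewrite subv_add Lu -memvE.
rewrite expnS natrM invfM -mulrA [RHS]mulrCA; congr (_ * _).
rewrite mulr_sumr.
rewrite [RHS](eq_bigr (fun h => if Umx (g ^ h)%g - 1%:M \in L
  then theta (dual_extend l (Umx (g ^ h)%g - 1%:M)) else 0)); last first.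
  move=> h; set A := Umx _ - _ => MA.
  transitivity (#|F|%:R^-1 *
      (theta (dual_extend l A) * \sum_(c : F) theta (c * phi A))).
    congr (_ * _); rewrite mulr_sumr; apply: eq_bigr => c _.
    rewrite -thetaD -(dual_restrictK phi (Mu A MA)) !dual_extendE.
    by rewrite add_lfunE scale_lfunE.
  rewrite (sum_theta_scale theta_neq0 thetaD theta_nontrivial).
  rewrite (separating_functional_ker Lphi phim MA).
  case: ifP => _; last by rewrite !mulr0.
  by rewrite mulrC mulfK // -[#|F|]expn1 card_field_neq0.
rewrite -big_mkcondr; apply: eq_bigl => h; rewrite andb_idl // => LA.
by apply: (subvP (addvSl _ _)).
Qed.

Definition cluster_sum (f : Ugrp n F -> C) :=
  exists ms : seq (udual n F), forall g, f g = \sum_(l <- ms) cluster_char theta l g.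

Lemma cluster_sum_big (I : Type) (r : seq I) (f : I -> Ugrp n F -> C) :
  (forall i, cluster_sum (f i)) -> cluster_sum (fun g => \sum_(i <- r) f i g).
Proof.
move=> fs; elim: r => [|i r [ms msE]].
  by exists [::] => g; rewrite !big_nil.
have [ms' msE'] := fs i; exists (ms' ++ ms) => g.
by rewrite big_cons big_cat /= msE msE'.
Qed.

Lemma eq_cluster_sum (f f' : Ugrp n F -> C) :
  f =1 f' -> cluster_sum f' -> cluster_sum f.
Proof. by move=> ff' [ms msE]; exists ms => g; rewrite ff'. Qed.

(** Induction on the codimension of L: each extension step adds one dimension, and
    a left ideal that equals the left annihilator of l gives a cluster character. *)
Lemma induced_char_cluster_sum L l :
  left_ideal L -> (L <= left_ann l)%VS -> cluster_sum (induced_char L l).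
Proof.
have [k] := ubnP (\dim u - \dim L); elim: k L l => // k IHk L l ltk idL Ll.
have annu : (left_ann l <= u)%VS by apply/subvP => A; apply: left_annU.
have [annL|annL] := boolP (left_ann l <= L)%VS.
  have -> : L = left_ann l by apply/eqP; rewrite eqEsubv Ll.
  by exists [:: l] => g; rewrite big_seq1 induced_left_ann.
have [m [ml mL umL]] := exists_minimal_step (@left_ann_ideal _ _ l) annu annL.
have Lu := subv_trans Ll annu; have mu := left_annU ml.
have [phi Lphi phim] := separating_functional mL.
apply: eq_cluster_sum (fun g => induced_char_step l g Lu mu mL Lphi phim) _.
apply: cluster_sum_big => c.
have uM X A : X \in u -> A \in (L + <[m]>)%VS -> X *m A \in L.
  move=> uX /memv_addP[v vL [_ /vlineP[a ->] ->]].
  by rewrite mulmxDr -scalemxAr rpredD ?memvZ ?umL //; apply: idL.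
have Mann : (L + <[m]> <= left_ann l)%VS by rewrite subv_add Ll -memvE.
apply: IHk.
- have ltLu : (\dim L < \dim u)%N.
    by rewrite -(dimv_add_line mL) dimvS // subv_add Lu -memvE.
  by rewrite dimv_add_line // subnS prednK ?subn_gt0.
- by move=> X A uX MA; apply: (subvP (addvSl _ _)); apply: uM.
apply/subvP => A MA; have /left_annP[uA lA] := subvP Mann _ MA.
(* l + c phi vanishes at X A: l because A annihilates it, phi because X A is in L. *)
apply/left_annP; split=> // X uX; have XAu := ualg_mulmx uX uA.
rewrite dual_extendE add_lfunE scale_lfunE -!dual_extendE lA // add0r.
rewrite dual_restrictK //; have := uM _ _ uX MA.
by move/(subvP Lphi); rewrite memv_ker => /eqP->; rewrite scaler0.
Qed.

Lemma prod_cluster_sum (J : finType) (ls : J -> udual n F) :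
  cluster_sum (fun g => \prod_j cluster_char theta (ls j) g).
Proof.
set S := [set f : {ffun J -> fdual} | [forall j, f j \in cluster (ls j)]].
have actS : [acts [set: Ugrp n F], on S | family_action J].
  apply/actsP => h _ f; rewrite !inE; apply: eq_forallb => j; rewrite ffunE.
  apply/imsetP/imsetP => -[h' _ fh'].
    by exists (h * h')%g; rewrite // -dual_actM -fh' dual_actM mulgV dual_act1.
  by exists (h^-1 * h')%g; rewrite // fh' dual_actM.
apply: eq_cluster_sum (fun g => prod_cluster_char ls g) _.
pose orbits := [set orbit (family_action J) [set: Ugrp n F] f | f in S].
apply: (eq_cluster_sum (f' := fun g => \sum_(O <- enum orbits)
   if [pick f in O] is Some f
   then induced_char (family_ann f) (\sum_j (f j : udual n F)) g
   else 0)).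
  move=> g; rewrite big_enum big_mkcondr /=.
  rewrite (set_partition_big _ (orbit_partition actS)) /=.
  apply: eq_bigr => _ /imsetP[f Sf ->].
  case: pickP => [f' /orbit_eqP <-|/(_ f)]; last by rewrite orbit_refl.
  by rewrite -family_orbit_sum big_mkcondr.
apply: cluster_sum_big => O; case: pickP => [f _|_]; last first.
  by exists [::] => g; rewrite big_nil.
apply: induced_char_cluster_sum.
  move=> X A uX /family_annP[uA fA]; apply/family_annP.
  split; first exact: ualg_mulmx.
  by move=> j; apply: left_ann_ideal.
apply/subvP => A /family_annP[uA fA]; apply/left_annP; split=> // X uX.
rewrite dual_extend_sum big1 // => j _.
by have /left_annP[_ ->] := fA j.
Qed.

End ClusterCharacters.

Theorem theorem7p8 (R : realType) (n : nat) (n_gt0 : (0 < n)%N)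
    (F : finFieldType) (theta : F -> R[i])
    (theta_neq0 : forall x : F, theta x != 0)
    (thetaD : {morph theta : x y / x + y >-> x * y})
    (theta_nontrivial : exists x : F, theta x != 1)
    (ls : seq (udual n F)) :
  exists ms : seq (nat * udual n F),
    forall g : Ugrp n F,
      \prod_(l <- ls) cluster_char theta l g =
      \sum_(m <- ms) m.1%:R * cluster_char theta m.2 g.
Proof.
have [ms msE] := prod_cluster_sum theta_neq0 thetaD theta_nontrivial (tnth (in_tuple ls)).
exists [seq (1%N, l) | l <- ms] => g; rewrite big_map (big_tnth _ _ ls).
by rewrite [LHS]msE; apply: eq_bigr => l _; rewrite mul1r.
Qed.
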